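(* Let $p\ge 5$ be a prime, $m\ge 1$ an integer, and $q=p^m$ with $q\equiv 2\pmod 3$. Let $V_{\mathrm{AGM}}=\{(u,v)\in\mathbb{F}_q^2\mid v\ne 0,\ u^3\ne v^3\}$. Then each $(u_{i+1},v_{i+1})\in V_{\mathrm{AGM}}$ has a unique parent in the cubic AGM graph over $\mathbb{F}_q$, i.e. there is a unique $(u_i,v_i)\in V_{\mathrm{AGM}}$ such that $$u_{i+1}=\frac{u_i+2v_i}{3},\qquad v_{i+1}^3=\frac{v_i(u_i^2+u_iv_i+v_i^2)}{3}.$$ More explicitly, if $\xi_i\in\mathbb{F}_q$ is the unique element satisfying $\xi_i^3=v_{i+1}^3-u_{i+1}^3$, then the parent is given by $$(u_i,v_i)=(u_{i+1}-2\xi_i,\ u_{i+1}+\xi_i).$$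
   Context: Since $q\equiv 2\pmod 3$, every element of $\mathbb{F}_q$ has a unique cube root in $\mathbb{F}_q$. The cubic AGM graph over $\mathbb{F}_q$ is the directed graph with vertex set $V_{\mathrm{AGM}}$ and with a directed edge $(u,v)\to(u',v')$ between vertices exactly when $u'=\frac{u+2v}{3}$ and $v'^3=\frac{v(u^2+uv+v^2)}{3}$. The initial vertex of an edge is called a parent of its terminal vertex. *)

(* Defs.v *)
From mathcomp Require Import all_boot all_order all_algebra.

Set Implicit Arguments.
Unset Strict Implicit.
Unset Printing Implicit Defensive.

Import GRing.Theory.
Local Open Scope ring_scope.

Definition V_AGM (F : finFieldType) : {set F * F} :=
  [set w : F * F | (w.2 != 0) && (w.1 ^+ 3 != w.2 ^+ 3)].

(* The directed edge runs from the first argument (the parent) to the second. *)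
Definition agm_edge (F : finFieldType) : rel (F * F) := fun w w' =>
  [&& w \in V_AGM F, w' \in V_AGM F,
      w'.1 == (w.1 + 2 * w.2) / 3
    & w'.2 ^+ 3 == w.2 * (w.1 ^+ 2 + w.1 * w.2 + w.2 ^+ 2) / 3].

Definition agm_parent (F : finFieldType) (w' w : F * F) : Prop := agm_edge w w'.

(* Main.v *)
(** As q = 3k + 2, we have 3 (2k + 1) = 2q - 1, so x^(3 (2k + 1)) = x for all x
    and cubing is bijective, with inverse the (2k + 1)-st power.  The linear
    edge equation says exactly (u, v) = (u' - 2 xi, u' + xi) with xi = v - u',
    and this substitution turns the cubic one into v'^3 = u'^3 + xi^3. *)
Require Import Defs.
From mathcomp Require Import all_boot all_order all_algebra all_field.
From mathcomp Require Import ring.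

Set Implicit Arguments.
Unset Strict Implicit.
Unset Printing Implicit Defensive.

Import GRing.Theory.
Local Open Scope ring_scope.

Section CubeRoots.

Variables (F : finFieldType) (F_mod3 : (#|F| = 2 %[mod 3])%N).

Let card_F : #|F| = (#|F| %/ 3 * 3 + 2)%N.
Proof. by rewrite {1}(divn_eq #|F| 3) F_mod3. Qed.

Lemma three_neq0 : 3 != 0 :> F.
Proof.
apply/eqP => three0.
(* Translation by 1 permutes F, so #|F| = 0 in F. *)
have card0 : #|F|%:R = 0 :> F.
  apply: (addrI (\sum_(x : F) x)); rewrite addr0.
  rewrite [RHS](reindex_inj (addIr 1)) big_split /=.
  by rewrite sumr_const.
(* Once 3 = 0, the cardinality 3k + 2 reduces to 2 in [F], so 2 and 3 both vanish. *)
move: card0; rewrite card_F natrD natrM three0 mulr0 add0r => two0.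
have : 1 = 3 - 2 :> F by ring.
by rewrite three0 two0 subr0 => /eqP; rewrite oner_eq0.
Qed.

Lemma exp_cube_card (x : F) : x ^+ (3 * (2 * (#|F| %/ 3) + 1)) = x.
Proof.
(* The exponent is split as q + (q - 1) so that x^q = x can be applied twice; unlike x^(q-1) = 1,
   this also covers x = 0. *)
have -> : (3 * (2 * (#|F| %/ 3) + 1) = #|F| + (#|F| %/ 3 * 3 + 1))%N.
  by rewrite {2}card_F; ring.
by rewrite exprD expf_card -exprS -addnS -card_F expf_card.
Qed.

Lemma cube_inj : injective (fun x : F => x ^+ 3).
Proof.
move=> x y /= xy.
by rewrite -[x]exp_cube_card exprM xy -exprM exp_cube_card.
Qed.

Lemma exists_unique_cube_root (y : F) : exists! x : F, x ^+ 3 = y.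
Proof.
have root_y : (y ^+ (2 * (#|F| %/ 3) + 1)) ^+ 3 = y.
  by rewrite -exprM mulnC exp_cube_card.
exists (y ^+ (2 * (#|F| %/ 3) + 1)); split=> // x x3.
by apply: cube_inj; rewrite /= root_y x3.
Qed.

Lemma agm_parent_cube_root (u' v' xi : F) :
  (u', v') \in V_AGM F -> xi ^+ 3 = v' ^+ 3 - u' ^+ 3 ->
  agm_parent (u', v') (u' - 2 * xi, u' + xi).
Proof.
move=> vertex xi3; have F3 := three_neq0.
rewrite /agm_parent /agm_edge vertex /=.
move: vertex; rewrite !inE /= => /andP[v'0 u'v'].
have v'3 : v' ^+ 3 = u' ^+ 3 + xi ^+ 3 by rewrite xi3; ring.
apply/and3P; split; [apply/andP; split | apply/eqP; field | ] => //.
(* The new second coordinate u' + xi divides u'^3 + xi^3 = v'^3, so it cannot vanish. *)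
- apply: contra v'0 => /eqP v0.
  have <- : (v' ^+ 3 == 0) = (v' == 0) by rewrite expf_eq0.
  rewrite v'3 (_ : _ + _ = (u' + xi) * (u' ^+ 2 - u' * xi + xi ^+ 2)); last by ring.
  by rewrite v0 mul0r.
(* Equal cubes have equal roots, and the two coordinates differ by 3 xi; then xi = 0 and v'^3 =
   u'^3. *)
- apply: contra u'v' => /eqP /cube_inj uv.
  have /eqP : 3 * xi = 0.
    rewrite (_ : 3 * xi = (u' + xi) - (u' - 2 * xi)); last by ring.
    by rewrite uv subrr.
  rewrite mulf_eq0 (negbTE F3) /= => /eqP xi0.
  by rewrite v'3 xi0 expr0n addr0.
- by apply/eqP; rewrite v'3; field.
Qed.

(** This is the uniqueness half: every parent arises from a cube root, namely v - u'. *)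
Lemma agm_parentE (u' v' u v : F) :
  agm_parent (u', v') (u, v) ->
  (v - u') ^+ 3 = v' ^+ 3 - u' ^+ 3 /\ u = u' - 2 * (v - u').
Proof.
have F3 := three_neq0.
case/and4P=> _ _ /= /eqP-> /eqP->.
by split; field.
Qed.

End CubeRoots.

Theorem theorem3p2 (p m q : nat) (F : finFieldType)
    (p_prime : prime p) (p_ge5 : (5 <= p)%N) (m_ge1 : (1 <= m)%N)
    (q_def : q = (p ^ m)%N) (q_mod3 : (q = 2 %[mod 3])%N) (F_card : #|F| = q)
    (u' v' : F) (w'_vertex : (u', v') \in V_AGM F) :
  (exists! w : F * F, agm_parent (u', v') w) /\
  (exists! xi : F, xi ^+ 3 = v' ^+ 3 - u' ^+ 3) /\
  (forall xi : F, xi ^+ 3 = v' ^+ 3 - u' ^+ 3 ->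
     agm_parent (u', v') (u' - 2 * xi, u' + xi)).
Proof.
rewrite -F_card in q_mod3.
have root := exists_unique_cube_root q_mod3 (v' ^+ 3 - u' ^+ 3).
split; last by split=> // xi; exact: agm_parent_cube_root.
have [xi [xi3 xi_uniq]] := root.
exists (u' - 2 * xi, u' + xi); split; first exact: agm_parent_cube_root.
case=> u v /(agm_parentE q_mod3)[v3 ->].
by rewrite (xi_uniq _ v3) (addrC u' (v - u')) subrK.
Qed.
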